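(* For every multi-index $\mathbf{k}$, the coefficients $D_{\mathbf{k},\boldsymbol\ell}$ satisfy $D_{\mathbf{k},\mathbf{0}}=\mathbf{k}!$ and $$D_{\mathbf{k},\boldsymbol\ell}=\sum_{a\in A}\sum_{\substack{j\ge 0\\ \ell_j^a\ge 1}}D_{\mathbf{k},\boldsymbol\ell-\mathbf{e}_j^a}\,\big(k_{j-1}^a-\ell_{j-1}^a+\ell_j^a\big)$$ for every nonzero lowering multi-index $\boldsymbol\ell$ such that $\mathbf{k}-\boldsymbol\ell+\overleftarrow{\boldsymbol\ell}\ge\mathbf{0}$, where $D_{\mathbf{k},\boldsymbol\ell-\mathbf{e}_j^a}$ is understood to be zero whenever $\mathbf{k}-(\boldsymbol\ell-\mathbf{e}_j^a)+\overleftarrow{\boldsymbol\ell-\mathbf{e}_j^a}$ has a negative component.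
   Context: $A$ is a finite set, $\mathbb{K}$ is a field of characteristic zero, and $I_A:=A\times\mathbb{Z}_{\ge -1}$. A multi-index is a finitely supported map $\mathbf{k}:I_A\to\mathbb{Z}_{\ge 0}$, written $k_j^a:=\mathbf{k}(a,j)$; $|\mathbf{k}|=\sum_{a\in A,\,j\ge -1}k_j^a$ and $\mathbf{k}!:=\prod_{a,j}k_j^a!$. $\mathbf{e}_j^a$ is the multi-index with $(a,j)$-coordinate $1$ and all others $0$; sums, differences and inequalities are componentwise. $N(A)$ is the polynomial algebra over $\mathbb{K}$ in the variables $x_j^a$ ($a\in A$, $j\ge -1$), and $\mathbf{x}^{\mathbf{k}}:=\prod_{a,j}(x_j^a)^{k_j^a}$. $\bar\partial:N(A)\to N(A)$ is the derivation with $\bar\partial(x_j^a)=x_{j-1}^a$ for $j\ge 0$ and $\bar\partial(x_{-1}^a)=0$. A lowering multi-index is a multi-index $\boldsymbol\ell$ on $I_A$ with $\ell_{-1}^a=0$ for all $a\in A$; its left shift $\overleftarrow{\boldsymbol\ell}$ is the multi-index with $(\overleftarrow{\boldsymbol\ell})_j^a:=\ell_{j+1}^a$ for $a\in A$, $j\ge -1$. The integers $C_{\mathbf{k},\boldsymbol\ell}$ ($\boldsymbol\ell$ a lowering multi-index) are the unique integers with $$\bar\partial^{\,r}\mathbf{x}^{\mathbf{k}}=\sum_{|\boldsymbol\ell|=r}C_{\mathbf{k},\boldsymbol\ell}\,\mathbf{x}^{\mathbf{k}-\boldsymbol\ell+\overleftarrow{\boldsymbol\ell}}\qquad(r\ge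 0)$$ (sum over lowering multi-indices) and $C_{\mathbf{k},\boldsymbol\ell}=0$ whenever $\mathbf{k}-\boldsymbol\ell+\overleftarrow{\boldsymbol\ell}$ has a negative component (monomials with a negative exponent are understood to be zero). Define $$D_{\mathbf{k},\boldsymbol\ell}:=\begin{cases}C_{\mathbf{k},\boldsymbol\ell}\,(\mathbf{k}-\boldsymbol\ell+\overleftarrow{\boldsymbol\ell})!,&\text{if }\mathbf{k}-\boldsymbol\ell+\overleftarrow{\boldsymbol\ell}\ge\mathbf{0},\\ 0,&\text{otherwise.}\end{cases}$$ *)

(* Defs.v *)
From mathcomp Require Import all_boot all_order all_algebra finmap.
From mathcomp Require Import boolp classical_sets functions cardinality fsbigop.
From mathcomp Require Import monalg zify.

Set Implicit Arguments.
Unset Strict Implicit.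
Unset Printing Implicit Defensive.

Import Order.TTheory GRing.Theory Num.Theory.
Local Open Scope ring_scope.

Notation "1" := (@mone _) : monom_scope.
Notation "x * y" := (mmul x y) : monom_scope.

(* The level j >= -1 is encoded by the natural number j + 1: the pair (a, n)   *)
(* stands for the index (a, n - 1). Hence, for j >= 0, the coordinate k_j^a is *)
(* k (a, j.+1) and k_{j-1}^a is k (a, j); in particular k_{-1}^a is k (a, 0).  *)
(* The library writes multi-indices multiplicatively: 1%M is the zero          *)
(* multi-index, (m1 * m2)%M and divcm m1 m2 are the componentwise sum and      *)
(* (truncated) difference, ucm i is the unit multi-index at i, and mdeg m is   *)
(* the total degree |m|.                                                       *)
Notation mindex A := {cmonom (A * nat)%type}.

Notation multipoly K A := {malg K[mindex A]}.

Section Monomials.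
Context (K : fieldType) (M : conomType).
Implicit Types m : M.

Lemma malgUZ (c : K) m : << c *g m >> = c *: << m >> :> {malg K[M]}.
Proof. by apply/malgP => m'; rewrite mcoeffZ !mcoeffU mulr_natr. Qed.

Lemma malgU1 : << 1%M >> = 1 :> {malg K[M]}.
Proof. exact: mpolyC1E. Qed.

Lemma malgUM m1 m2 : << (m1 * m2)%M >> = << m1 >> * << m2 >> :> {malg K[M]}.
Proof. by rewrite malgM_def fgmulUU mulr1. Qed.

Lemma malgUX m n : << m >> ^+ n = << iter n (mmul m) 1%M >> :> {malg K[M]}.
Proof.
by elim: n => [|n IHn]; rewrite ?expr0 ?malgU1 // iterS malgUM -IHn exprS.
Qed.

Lemma malgU_prod (T : Type) (s : seq T) (F : T -> M) :
  << \big[mmul/1%M]_(x <- s) F x >> = \prod_(x <- s) << F x >> :> {malg K[M]}.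
Proof. exact: (big_morph _ malgUM malgU1). Qed.

End Monomials.

Lemma scale_natr_eq (K : fieldType) (V : lmodType K) (n : nat) (x y : V) :
  (n != 0%N -> x = y) -> n%:R *: x = n%:R *: y.
Proof. by case: n => [|n] xy; rewrite ?scale0r ?xy. Qed.

Section LinearExtension.
Context (K : fieldType) (M : conomType) (D : M -> {malg K[M]}).
Implicit Types (g h : {malg K[M]}) (m : M).

(* The K-linear map sending each monomial << m >> to D m. *)
Definition mlin g : {malg K[M]} := \sum_(m <- msupp g) g@_m *: D m.

Lemma mlinEw g (d : {fset M}) : (msupp g `<=` d)%fset ->
  mlin g = \sum_(m <- d) g@_m *: D m.
Proof.
move=> gd; rewrite /mlin (big_fset_incl _ gd) // => m _ /mcoeff_outdom->.
by rewrite scale0r.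
Qed.

Lemma mlin_linear (c : K) g h : mlin (c *: g + h) = c *: mlin g + mlin h.
Proof.
set d := (msupp g `|` msupp h)%fset.
have gd : (msupp g `<=` d)%fset by apply: fsubsetUl.
have hd : (msupp h `<=` d)%fset by apply: fsubsetUr.
have sd : (msupp (c *: g + h) `<=` d)%fset.
  by apply: fsubset_trans (msuppD_le _ _) _; apply: fsetSU; apply: msuppZ_le.
rewrite (mlinEw gd) (mlinEw hd) (mlinEw sd) scaler_sumr -big_split /=.
by apply: eq_bigr => m _; rewrite mcoeffD mcoeffZ scalerDl scalerA.
Qed.

Lemma mlinU m : mlin << m >> = D m.
Proof. by rewrite /mlin msuppU1 big_seq_fset1 mcoeffUU scale1r. Qed.

Lemma malg_linear_ind (P : {malg K[M]} -> Prop) :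
  P 0 -> (forall (c : K) m g, P g -> P (c *: << m >> + g)) -> forall g, P g.
Proof.
move=> P0 PS g; rewrite (monalgE g); elim: (X in \sum_(_ <- X) _) => [|m s IHs].
  by rewrite big_nil.
by rewrite big_cons malgUZ; apply: PS.
Qed.

Lemma mlin0 : mlin 0 = 0.
Proof. by rewrite /mlin msupp0 big_seq_fset0. Qed.

Lemma mlin_leibniz g h :
  (forall m1 m2, D (m1 * m2)%M = D m1 * << m2 >> + << m1 >> * D m2) ->
  mlin (g * h) = mlin g * h + g * mlin h.
Proof.
move=> DM; elim/malg_linear_ind: g => [|c m1 g IHg].
  by rewrite mul0r mlin0 !mul0r addr0.
rewrite mulrDl -scalerAl !mlin_linear IHg mlinU.
suff -> : mlin (<< m1 >> * h) = D m1 * h + << m1 >> * mlin h.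
  by rewrite !mulrDl -!scalerAl scalerDr addrACA.
elim/malg_linear_ind: h {IHg} => [|d m2 h IHh].
  by rewrite mulr0 mlin0 !mulr0 addr0.
rewrite mulrDr -scalerAr !mlin_linear IHh mlinU -malgUM mlinU DM.
by rewrite !mulrDr -!scalerAr scalerDr addrACA.
Qed.

Lemma mlin_unique (d : {malg K[M]} -> {malg K[M]}) :
  (forall (c : K) g h, d (c *: g + h) = c *: d g + d h) ->
  (forall m, d << m >> = D m) -> d =1 mlin.
Proof.
move=> dL dU; have d0 : d 0 = 0.
  by have /esym/(canRL (addKr _)) := dL 1 0 0; rewrite !scale1r addr0 addNr.
elim/malg_linear_ind => [|c m g IHg]; first by rewrite d0 mlin0.
by rewrite dL dU IHg mlin_linear mlinU.
Qed.

End LinearExtension.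

Section MultiIndices.
Context (A : finType).
Implicit Types (k l m : mindex A) (i : A * nat).

Definition mfact m : nat := (\prod_(i <- finsupp m) (m i)`!)%N.

Definition lowering l : bool := [forall a : A, l (a, 0%N) == 0%N].

Definition lshift l : mindex A :=
  [cmonom l (i.1, i.2.+1) | i in [fset (i.1, i.2.-1) | i in finsupp l]]%M.

Lemma lshiftE l i : lshift l i = l (i.1, i.2.+1).
Proof.
rewrite cmE fsfunE; case: ifPn => //= iN; apply/esym/eqP.
rewrite cmE_eq0; apply: contra iN => il; apply/imfsetP.
by exists (i.1, i.2.+1) => //; case: i {il}.
Qed.

(* The exponent k - l + lshift l, which may have negative components. *)
Definition lowexp k l i : int := (k i)%:Z - (l i)%:Z + (lshift l i)%:Z.

Definition lowexp_ge0 k l : Prop := forall i, 0 <= lowexp k l i.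

(* The same exponent as a multi-index, when its components are nonnegative. *)
Definition lowmexp k l : mindex A := divcm (k * lshift l)%M l.

Lemma lowmexpE k l i : lowexp_ge0 k l -> (lowmexp k l i)%:Z = lowexp k l i.
Proof. by move=> /(_ i); rewrite /lowexp /lowmexp divcmE cmM; lia. Qed.

Definition lowD (C : mindex A -> mindex A -> int) k l : int :=
  if `[< lowexp_ge0 k l >] then C k l * (mfact (lowmexp k l))%:Z else 0.

Lemma loweringP l : reflect (forall a, l (a, 0%N) = 0%N) (lowering l).
Proof. by apply: (iffP forallP) => h a; apply/eqP. Qed.

Lemma lowexp0 k i : lowexp k 1%M i = k i.
Proof. by rewrite /lowexp lshiftE !cm1; lia. Qed.

Lemma lowmexp0 k : lowmexp k 1%M = k.
Proof. by apply/eqP/cmP => i; rewrite divcmE cmM lshiftE !cm1 addn0 subn0. Qed.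

Lemma lowexpMU k l a j i :
  lowexp k (l * ucm (a, j.+1))%M i =
  lowexp k l i - (i == (a, j.+1))%:Z + (i == (a, j))%:Z.
Proof.
rewrite /lowexp !lshiftE !cmM !cmU; case: i => b n /=.
by rewrite !xpair_eqE !(eq_sym b); case: (a == b); lia.
Qed.

Lemma lowmexp_inj k l l' : lowering l -> lowering l' ->
  lowexp_ge0 k l -> lowexp_ge0 k l' -> lowmexp k l = lowmexp k l' -> l = l'.
Proof.
move=> /loweringP l0 /loweringP l'0 p p' e; apply/eqP/cmP => -[a n].
elim: n => [|n IHn]; first by rewrite l0 l'0.
have := lowmexpE (a, n) p'; rewrite -e lowmexpE // /lowexp !lshiftE /= IHn.
by move/addrI=> [].
Qed.

End MultiIndices.

Section Derivation.
Context (K : fieldType) (A : finType).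
Implicit Types (g h : multipoly K A) (k l m : mindex A) (i : A * nat).

Lemma monomE k : << k >> = \prod_(i <- finsupp k) << ucm i >> ^+ k i
  :> multipoly K A.
Proof.
have iterE m n i : iter n (mmul m) 1%M i = (n * m i)%N.
  by elim: n => [|n IHn]; rewrite ?cm1 // iterS cmM IHn mulSn.
under eq_bigr do rewrite malgUX.
rewrite -malgU_prod.
congr (<< _ >>); apply/eqP/cmP => j.
rewrite (big_morph (fun m : mindex A => m j) (fun m1 m2 => cmM j m1 m2) (cm1 j)).
under eq_bigr do rewrite iterE cmU.
have [jk|jk] := boolP (j \in finsupp k).
  rewrite (big_fsetD1 j) //= eqxx muln1 big1_fset ?addn0 // => i.
  by rewrite in_fsetD1 => /andP[/negPf->]; rewrite muln0.
rewrite big1_fset => [|i ik _]; first by apply/eqP; rewrite cmE_eq0.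
by have [e|_] := eqVneq i j; [rewrite -e ik in jk | rewrite muln0].
Qed.

Definition dbar_var i : multipoly K A :=
  if i is (a, j.+1) then << ucm (a, j) >> else 0.

Definition dbar_mon m : multipoly K A :=
  \sum_(i <- finsupp m) (m i)%:R *: (dbar_var i * << divcm m (ucm i) >>).

(* The derivation of the polynomial algebra with values dbar_var on the        *)
(* variables; see dbar_linear, dbar_leibniz and dbarX.                         *)
Definition dbar g : multipoly K A := mlin dbar_mon g.

Lemma dbar_linear (c : K) g h : dbar (c *: g + h) = c *: dbar g + dbar h.
Proof. exact: mlin_linear. Qed.

Lemma dbar_monEw m (d : {fset A * nat}) : (finsupp m `<=` d)%fset ->
  dbar_mon m =
  \sum_(i <- d) (m i)%:R *: (dbar_var i * << divcm m (ucm i) >>).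
Proof.
move=> md; rewrite /dbar_mon (big_fset_incl _ md) // => i _.
by rewrite -cmE_eq0 => /eqP->; rewrite scale0r.
Qed.

Lemma divcmMl m1 m2 i : m1 i != 0%N ->
  divcm (m1 * m2)%M (ucm i) = (divcm m1 (ucm i) * m2)%M.
Proof.
move=> m1i; apply/eqP/cmP => j; rewrite cmM !divcmE cmM cmU.
by have [<-|] := eqVneq i j; lia.
Qed.

Lemma dbar_monM m1 m2 :
  dbar_mon (m1 * m2)%M = dbar_mon m1 * << m2 >> + << m1 >> * dbar_mon m2.
Proof.
rewrite (dbar_monEw (fsubset_refl _)) mdomD.
rewrite (dbar_monEw (fsubsetUl _ (finsupp m2))).
rewrite (@dbar_monEw m2 _ (fsubsetUr (finsupp m1) _)).
rewrite mulr_suml mulr_sumr -big_split /=; apply: eq_bigr => i _.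
rewrite cmM natrD scalerDl; congr (_ + _).
  rewrite -scalerAl -mulrA -malgUM; apply: scale_natr_eq => m1i.
  by rewrite divcmMl.
rewrite -scalerAr mulrCA -malgUM; apply: scale_natr_eq => m2i.
by congr (_ * << _ >>); rewrite (mulmC m1 m2) divcmMl // mulmC.
Qed.

Lemma dbar_leibniz g h : dbar (g * h) = dbar g * h + g * dbar h.
Proof. exact: (mlin_leibniz g h dbar_monM). Qed.

Lemma dbarX i : dbar << ucm i >> = dbar_var i.
Proof.
apply: etrans (mlinU dbar_mon (ucm i)) _.
rewrite /dbar_mon mdomU big_seq_fset1 cmUU scale1r.
rewrite (_ : divcm _ _ = 1%M) ?malgU1 ?mulr1 //.
by apply/eqP/cmP => j; rewrite divcmE subnn cm1.
Qed.

(* Monomials with a negative exponent are zero. *)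
Definition lowmon k l : multipoly K A :=
  if `[< lowexp_ge0 k l >] then << lowmexp k l >> else 0.

(* The coefficient C_{k,l} is C k l; the values at non-lowering l are          *)
(* unconstrained. The index set is infinite, but lowmon k l is nonzero for     *)
(* only finitely many l in it (finite_lower_ok). Such a family exists, and is  *)
(* unique on lowering l when K has characteristic zero (lowering_coefs_exist,  *)
(* lowering_coefs_unique).                                                     *)
Definition lowering_coefs (C : mindex A -> mindex A -> int) : Prop :=
  (forall k r, iter r dbar << k >> =
     \sum_(l \in [set l | lowering l /\ mdeg l = r]%classic)
        (C k l)%:~R *: lowmon k l) /\
  (forall k l, lowering l -> ~ lowexp_ge0 k l -> C k l = 0).

End Derivation.

Lemma sum_by_fst (K : fieldType) (V : lmodType K) (T : eqType)
    (s : seq (T * nat)) (f : T -> V) :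
  \sum_(x <- s) x.2%:R *: f x.1 =
  \sum_(l <- undup [seq x.1 | x <- s])
     (\sum_(x <- s | x.1 == l) x.2)%N%:R *: f l.
Proof.
under [RHS]eq_bigr do rewrite natr_sum scaler_suml.
rewrite [RHS](exchange_big_dep xpredT) //=.
rewrite [LHS]big_seq [RHS]big_seq; apply: eq_bigr => x xs.
rewrite big_mkcond (bigD1_seq x.1) ?undup_uniq //=; last first.
  by rewrite mem_undup; apply/mapP; exists x.
by rewrite eqxx big1 ?addr0 // => l /negPf; rewrite eq_sym => ->.
Qed.

Lemma mlin_sum (K : fieldType) (M : conomType) (D : M -> {malg K[M]})
    (T : Type) (s : seq T) (c : T -> K) (m : T -> M) :
  mlin D (\sum_(x <- s) c x *: << m x >>) = \sum_(x <- s) c x *: D (m x).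
Proof.
elim: s => [|x s IHs]; first by rewrite !big_nil mlin0.
by rewrite !big_cons mlin_linear mlinU IHs.
Qed.

Lemma mcoeff_sum_inj (K : fieldType) (M : conomType) (T : eqType)
    (s : seq T) (c : T -> K) (f : T -> M) (x : T) :
  uniq s -> x \in s -> {in s &, injective f} ->
  (\sum_(y <- s) c y *: << f y >>)@_(f x) = c x.
Proof.
move=> us xs finj; rewrite raddf_sum (bigD1_seq x) //= mcoeffZ mcoeffUU mulr1.
rewrite big_seq_cond big1 ?addr0 // => y /andP[ys yx].
by rewrite mcoeffZ mcoeffU (inj_in_eq finj) // (negPf yx) mulr0.
Qed.

Lemma mcoeff_fsum (K : fieldType) (M : conomType) (T : choiceType)
    (B : set T) (r : {fset T}) (c : T -> K) (f : T -> M) (F : T -> {malg K[M]})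
    (x : T) :
  (forall y, y \in r -> B y) -> (forall y, B y -> y \notin r -> F y = 0) ->
  (forall y, y \in r -> F y = c y *: << f y >>) -> x \in r ->
  {in r &, injective f} -> (\sum_(y \in B) F y)@_(f x) = c x.
Proof.
move=> rB F0 FE xr finj; rewrite (fsbigE r) ?fset_uniq //.
rewrite -(mcoeff_sum_inj c (fset_uniq r) xr finj); congr mcoeff.
rewrite big_seq_cond [RHS]big_seq; apply: eq_big => [y|y /andP[/FE->]] //.
by case: (boolP (y \in r)) => //= /rB yB; rewrite mem_set.
Qed.

Section Existence.
Context (K : fieldType) (A : finType).
Implicit Types (k l m : mindex A).

Definition lower_ok k r l := [/\ lowering l, mdeg l = r & lowexp_ge0 k l].

Lemma lower_okMU k r l a j : lower_ok k r l -> lowmexp k l (a, j.+1) != 0%N ->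
  lower_ok k r.+1 (l * ucm (a, j.+1))%M /\
  lowmexp k (l * ucm (a, j.+1))%M =
    (ucm (a, j) * divcm (lowmexp k l) (ucm (a, j.+1)))%M.
Proof.
move=> [/loweringP l0 dl p] mn0.
have e i := lowexpMU k l a j i.
have pos : lowexp_ge0 k (l * ucm (a, j.+1))%M.
  move=> i; rewrite e -lowmexpE //; have [->|] := eqVneq i (a, j.+1); lia.
split; first split => //.
- by apply/loweringP => b; rewrite cmM l0 cmU; case: eqP => // -[].
- by rewrite mdegM dl mdegU addn1.
apply/eqP/cmP => i; have := lowmexpE i pos; rewrite e -lowmexpE //.
rewrite cmM divcmE !cmU !(eq_sym _ i).
have [->|_] := eqVneq i (a, j.+1); move: (lowmexp k (l * _)%M _) (_ == (a, j)).
  by move: (lowmexp k l _) mn0 => x x0 y b /=; case: b; lia.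
by move: (lowmexp k l i) => x y b /=; case: b; lia.
Qed.

Definition stepseq k l : seq (mindex A * nat) :=
  [seq ((l * ucm i)%M, lowmexp k l i) | i <- finsupp (lowmexp k l) & 0 < i.2]%N.

Lemma dbar_mon_step k r l : lower_ok k r l ->
  dbar_mon K (lowmexp k l) =
  \sum_(y <- stepseq k l) y.2%:R *: << lowmexp k y.1 >>.
Proof.
move=> ok; rewrite /stepseq big_map big_filter /dbar_mon [RHS]big_mkcond /=.
rewrite [LHS]big_seq [RHS]big_seq; apply: eq_bigr => -[a [|j]] ij /=.
  by rewrite mul0r scaler0.
have [|_ ->] := lower_okMU (a := a) (j := j) ok; first by rewrite cmE_eq0 negbK.
by rewrite malgUM.
Qed.

Lemma iter_dbarE k r : exists s : seq (mindex A * nat),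
  (forall x, x \in s -> lower_ok k r x.1) /\
  iter r (@dbar K A) << k >> = \sum_(x <- s) x.2%:R *: << lowmexp k x.1 >>.
Proof.
elim: r => [|r [s [sok sE]]].
  exists [:: (1%M, 1%N)]; split => [x|].
    rewrite inE => /eqP-> /=; split; rewrite ?mdeg1 //.
      by apply/loweringP => a; rewrite cm1.
    by move=> i; rewrite lowexp0.
  by rewrite big_seq1 /= scale1r lowmexp0.
exists [seq (y.1, x.2 * y.2)%N | x <- s, y <- stepseq k x.1]; split.
  move=> x /allpairsPdep [y [z [ys]]] /mapP[[a [|j]]]; rewrite mem_filter //=.
  move=> ij -> -> /=; have [|//] := lower_okMU (a := a) (j := j) (sok _ ys).
  by rewrite cmE_eq0 negbK.
rewrite big_allpairs_dep iterS sE [LHS]mlin_sum.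
rewrite [LHS]big_seq [RHS]big_seq; apply: eq_bigr => x xs.
rewrite (dbar_mon_step (sok _ xs)) scaler_sumr; apply: eq_bigr => y _ /=.
by rewrite natrM scalerA.
Qed.

Lemma lowering_coefs_exist : exists C, lowering_coefs K (A := A) C.
Proof.
pose s k r := sval (cid (iter_dbarE k r)).
have sP k r : (forall x, x \in s k r -> lower_ok k r x.1) /\
    iter r (@dbar K A) << k >> =
    \sum_(x <- s k r) x.2%:R *: << lowmexp k x.1 >>.
  by rewrite /s; case: cid.
exists (fun k l => if `[< lowexp_ge0 k l >] then
   (\sum_(x <- s k (mdeg l) | x.1 == l) x.2)%N%:Z else 0); split => [k r|k l _]; last first.
  by move=> /asboolPn/negPf->.
have [sok ->] := sP k r.
set t := undup [seq x.1 | x <- s k r].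
have tok l : l \in t -> lower_ok k r l.
  by rewrite mem_undup => /mapP[x /sok xok ->].
rewrite (fsbigE t) ?undup_uniq //.
- rewrite (sum_by_fst (s k r) (fun l => << lowmexp k l >>)).
  rewrite -/t [LHS]big_seq [RHS]big_seq_cond.
  apply: eq_big => [l|l /tok[_ dl /asboolT p]]; last by rewrite /lowmon p dl.
  by case: (boolP (l \in t)) => //= /tok[ll dl _]; rewrite mem_set.
- by move=> l /tok[].
move=> l [_ dl] lt; rewrite [X in X%:~R *: _](_ : _ = 0) ?scale0r //.
case: ifP => // _; rewrite dl big1_seq // => x /andP[/eqP xl xs].
by case/negP: lt; rewrite mem_undup -xl; apply: map_f.
Qed.

Lemma lower_okV k r l : lower_ok k r.+1 l ->
  exists l' i, [/\ lower_ok k r l', i \in finsupp (lowmexp k l') &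
    l = (l' * ucm i)%M].
Proof.
move=> [/loweringP l0 dl p].
have ex : exists n, [exists a, l (a, n) != 0%N].
  apply: contrapT => nex; suff l1 : l = 1%M by rewrite l1 mdeg1 in dl.
  apply/eqP/cmP => -[a n]; rewrite cm1; apply/eqP; apply: contrapT => /negP ln.
  by apply: nex; exists n; apply/existsP; exists a.
case: (ex_minnP ex) => -[|j] /existsP[a la] jmin; first by rewrite l0 in la.
have lj : l (a, j) = 0%N.
  apply/eqP; apply: contraT => lj; suff : (j < j)%N by rewrite ltnn.
  by apply: jmin; apply/existsP; exists a.
pose l' := divcm l (ucm (a, j.+1)).
have lE : l = (l' * ucm (a, j.+1))%M.
  apply/eqP/cmP => i; rewrite cmM divcmE cmU.
  by have [<-|_] := eqVneq (a, j.+1) i; rewrite ?subnK ?lt0n ?subn0 ?addn0.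
have e i := lowexpMU k l' a j i.
have p' : lowexp_ge0 k l'.
  move=> i; have := p i; have := e i; rewrite -lE.
  have [->|_] := eqVneq i (a, j); last first.
    by move: (lowexp k l i) (lowexp k l' i) => x y; case: (i == _) => /=; lia.
  have : 1 <= lowexp k l (a, j).
    by rewrite /lowexp lj lshiftE /=; move: (k _) (l _) la => x y; lia.
  by move: (lowexp k l _) (lowexp k l' _) (_ == _) => x y [] /=; lia.
exists l', (a, j.+1); split => //; last first.
  rewrite -cmE_neq0; have := lowmexpE (a, j.+1) p'; have := e (a, j.+1).
  rewrite -lE eqxx; have := p (a, j.+1).
  move: (lowexp k l _) (lowexp k l' _) (lowmexp k l' _) => x y z.
  by rewrite xpair_eqE eqxx (_ : (j.+1 == j) = false) /=; lia.
split => //; first by apply/loweringP => b; rewrite divcmE l0.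
by move: dl; rewrite lE mdegM mdegU addn1 => -[].
Qed.

Lemma finite_lower_ok k r : finite_set [set l | lower_ok k r l]%classic.
Proof.
elim: r => [|r IHr].
  apply: (@sub_finite_set _ _ [set 1%M]%classic); last exact: finite_set1.
  by move=> l [_ /mdeg_eq0I].
pose S := (\bigcup_(l in [set l | lower_ok k r l])
  [set (l * ucm i)%M | i in [set` finsupp (lowmexp k l)]])%classic.
apply: (@sub_finite_set _ _ S).
  by move=> l /lower_okV[l' [i [ok' ii ->]]]; exists l' => //; exists i.
by apply: bigcup_finite => // l _; apply: finite_image.
Qed.

Lemma lowering_coefs_unique (charK : [pchar K] =i pred0) C C' :
  lowering_coefs K C -> lowering_coefs K C' ->
  forall k l, lowering l -> C k l = C' k l.
Proof.
suff coefE C0 k l : lowering_coefs K C0 -> lower_ok k (mdeg l) l ->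
    (iter (mdeg l) (@dbar K A) << k >>)@_(lowmexp k l) = (C0 k l)%:~R.
  move=> hC hC' k l ll; have [p|np] := asboolP (lowexp_ge0 k l).
    have ok : lower_ok k (mdeg l) l by [].
    have := coefE _ _ _ hC ok; rewrite (coefE _ _ _ hC' ok) => /eqP.
    rewrite eq_sym -subr_eq0 -rmorphB /= => /eqP h; apply/eqP.
    rewrite -subr_eq0; move: (_ - _) h => z.
    have nz n : n%:R = 0 :> K -> n = 0%N.
      by move=> /eqP; rewrite ((pcharf0P K).1 charK) => /eqP.
    by case: z => n; rewrite ?NegzE ?rmorphN /= => /eqP;
      rewrite ?oppr_eq0 => /eqP /nz // ->.
  by rewrite hC.2 // hC'.2.
move=> [CE _] ok; rewrite CE.
set r := fset_set [set l' | lower_ok k (mdeg l) l']%classic.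
have inr l' : (l' \in r) = `[< lower_ok k (mdeg l) l' >].
  rewrite in_fset_set; last exact: finite_lower_ok.
  by apply/idP/asboolP; rewrite inE.
have rok l' : l' \in r -> lower_ok k (mdeg l) l' by rewrite inr => /asboolP.
have lr : l \in r by rewrite inr; apply/asboolP.
have finj : {in r &, injective (lowmexp k)}.
  by move=> l1 l2 /rok[ll1 _ p1] /rok[ll2 _ p2]; apply: lowmexp_inj.
apply: (@mcoeff_fsum K _ _ [set l' | lowering l' /\ mdeg l' = mdeg l]%classic r
  (fun l' => (C0 k l')%:~R) (lowmexp k)
  (fun l' => (C0 k l')%:~R *: lowmon K k l') l _ _ _ lr finj).
- by move=> l' /rok[].
- move=> l' /= [ll' dl']; rewrite inr => /asboolP nok.
  by rewrite /lowmon asboolF ?scaler0 // => p; apply: nok.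
- by move=> l' /rok[_ _ p]; rewrite /lowmon asboolT.
Qed.
End Existence.

(* Main.v *)
(* D_{k,l} is the value at 0 of the partial derivative of dbar^|l| x^k of order
   m = k - l + (left shift of l): it is m! times the coefficient of x^m. In
   this pairing the adjoint of dbar sends m to the sum over (a, j) of m_j^a
   times m - e_j^a + e_{j+1}^a. The multi-index m - e_{j-1}^a + e_j^a is the
   exponent attached to l - e_j^a, or to no lowering multi-index when
   l_j^a = 0, so reading off the value of dbar (dbar^(|l|-1) x^k) at m gives
   the recursion. *)

Require Import Defs.
From mathcomp Require Import all_boot all_order all_algebra finmap.
From mathcomp Require Import boolp classical_sets functions cardinality fsbigop.
From mathcomp Require Import monalg zify.

Import GRing.Theory Num.Theory.
Local Open Scope ring_scope.

(** * Factorials of multi-indices and sums over bounded levels *)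

Section MultiIndexFactorial.
Context {A : finType}.
Implicit Types (k l m n : mindex A) (i : A * nat).

Lemma mfactEw {m} {d : {fset A * nat}} :
  (finsupp m `<=` d)%fset -> mfact m = (\prod_(i <- d) (m i)`!)%N.
Proof.
move=> md; rewrite /mfact (big_fset_incl _ md) // => i _.
by rewrite -cmE_eq0 => /eqP->.
Qed.

Lemma mfactMU m i : mfact (m * ucm i)%M = (mfact m * (m i).+1)%N.
Proof.
have id : i \in (finsupp m `|` [fset i])%fset by rewrite !inE eqxx orbT.
rewrite (mfactEw (fsubsetUl (finsupp m) [fset i]%fset)).
rewrite (mfactEw (d := (finsupp m `|` [fset i])%fset)); last by rewrite mdomD mdomU.
rewrite !(big_fsetD1 i id) /= cmM cmUU addn1 factS -mulnA mulnC.
congr (_ * _ * _)%N; apply: eq_big_seq => j.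
by rewrite !inE cmM cmU eq_sym => /andP[/negPf-> _]; rewrite addn0.
Qed.

Lemma divcmUK m i : m i != 0%N -> (divcm m (ucm i) * ucm i)%M = m.
Proof.
move=> mi; apply/eqP/cmP => j; rewrite cmM divcmE cmU.
by have [<-|] := eqVneq i j; lia.
Qed.

Lemma mulUcmK m i : divcm (m * ucm i)%M (ucm i) = m.
Proof. by apply/eqP/cmP => j; rewrite divcmE cmM addnK. Qed.

Lemma finsupp_level_bound m :
  exists N, forall i, i \in finsupp m -> (i.2 < N)%N.
Proof.
exists (\max_(i <- finsupp m) i.2).+1 => i im.
by rewrite ltnS; exact: leq_bigmax_seq.
Qed.

(** The bound [N] need not be sharp, so sums over different supports can be brought to one common
    range and compared term by term. *)
Lemma sum_levels {V : nmodType} {d : {fset A * nat}} {N} (F : A * nat -> V) :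
  (forall i, i \in d -> (i.2 < N)%N) -> (forall i, i \notin d -> F i = 0) ->
  \sum_(i <- d) F i = \sum_(a : A) \sum_(j < N) F (a, val j).
Proof.
move=> dN F0; rewrite pair_bigA /=.
pose s := [seq (p.1, val p.2) | p : A * 'I_N].
have us : uniq s.
  rewrite map_inj_uniq ?enum_uniq // => -[a j] [b j'] [-> /= e].
  by congr pair; apply: val_inj.
transitivity (\sum_(i <- s) F i); last by rewrite big_map big_enum.
rewrite [RHS](bigID (mem d)) /= [X in _ + X]big1 ?addr0 => [|i /F0] //.
rewrite -[RHS]big_filter; apply: perm_big; apply: uniq_perm.
- exact: fset_uniq.
- exact: filter_uniq.
move=> [a j]; rewrite mem_filter /=; apply/idP/andP => [id|[]//]; split => //.
by apply/mapP; exists (a, Ordinal (dN _ id)); rewrite ?mem_enum.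
Qed.

End MultiIndexFactorial.

(** * Derivatives at 0 and the adjoint of [dbar] *)

Section TaylorCoefficient.
Context {K : fieldType} {A : finType}.
Implicit Types (g h : multipoly K A) (k l m n : mindex A) (i : A * nat).

(* The value at 0 of the iterated partial derivative of order m of g. *)
Definition tcoef m g : K := (mfact m)%:R * g@_m.

Lemma tcoef_linear m (c : K) g h :
  tcoef m (c *: g + h) = c * tcoef m g + tcoef m h.
Proof. by rewrite /tcoef mcoeffD mcoeffZ mulrDr mulrCA. Qed.

Lemma tcoef0 m : tcoef m 0 = 0.
Proof. by rewrite /tcoef mcoeff0 mulr0. Qed.

Lemma tcoefZU m (c : K) n :
  tcoef m (c *: << n >>) = (mfact m)%:R * (c * (n == m)%:R).
Proof. by rewrite /tcoef mcoeffZ mcoeffU. Qed.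

Lemma tcoef_sum m (T : Type) (s : seq T) (F : T -> multipoly K A) :
  tcoef m (\sum_(x <- s) F x) = \sum_(x <- s) tcoef m (F x).
Proof. by rewrite /tcoef raddf_sum mulr_sumr. Qed.

(** Variables of level 0 are killed by [dbar], so only levels [j.+1] contribute; hence the shift
    between the bound [N.+1] and the range [j < N]. *)
Lemma dbar_mon_levels {n N} : (forall i, i \in finsupp n -> (i.2 < N.+1)%N) ->
  dbar_mon K n = \sum_(a : A) \sum_(j < N) (n (a, j.+1))%:R *:
    << (ucm (a, val j) * divcm n (ucm (a, j.+1)))%M >>.
Proof.
move=> nN; rewrite /dbar_mon (sum_levels _ nN) => [|i]; last first.
  by rewrite -cmE_eq0 => /eqP->; rewrite scale0r.
apply: eq_bigr => a _; rewrite big_ord_recl /= mul0r scaler0 add0r.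
by apply: eq_bigr => j _; rewrite /= malgUM.
Qed.

Lemma dbarU n : dbar << n >> = dbar_mon K n.
Proof. exact: mlinU. Qed.

(** The subtraction is truncated, so this is the intended exponent only if [m i] is nonzero; in the
    adjoint formula it comes with the factor [m i]. *)
Definition raise i m : mindex A := (divcm m (ucm i) * ucm (i.1, i.2.+1))%M.

(* Both sides vanish unless m and n are obtained from a common multi-index p
   by adding the unit multi-index at level j, resp. j + 1. *)
Lemma tcoef_lower_unit m n i :
  (mfact m * (n (i.1, i.2.+1) *
     ((ucm i * divcm n (ucm (i.1, i.2.+1)))%M == m)))%N =
  (m i * (mfact (raise i m) * (n == raise i m)))%N.
Proof.
rewrite /raise; set i' := (i.1, i.2.+1).
have [n0|n0] := eqVneq (n i') 0%N.
  rewrite n0 mul0n muln0; case: eqP => [nE|_]; last by rewrite !muln0.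
  by move: n0; rewrite nE cmM cmUU; lia.
have [m0|m0] := eqVneq (m i) 0%N.
  rewrite m0 mul0n; case: eqP => [mE|_]; last by rewrite !muln0.
  by move: m0; rewrite -mE cmM cmUU; lia.
have [q qE] : exists q, n = (q * ucm i')%M.
  by exists (divcm n (ucm i')); rewrite divcmUK.
have [p pE] : exists p, m = (p * ucm i)%M.
  by exists (divcm m (ucm i)); rewrite divcmUK.
rewrite qE pE !mulUcmK (mulmC (ucm i)) !cmM !cmUU !mfactMU.
have inj (j : A * nat) : injective (fun r : mindex A => (r * ucm j)%M).
  by move=> r r' e; rewrite -(mulUcmK r j) e mulUcmK.
rewrite (inj_eq (inj i)) (inj_eq (inj i')).
by have [->|] := eqVneq q p; rewrite ?muln0 // !muln1 !addn1 [RHS]mulnCA mulnA.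
Qed.

(** Both sides are linear in [g]. On a monomial the two double sums, extended to the same levels,
    agree term by term by [tcoef_lower_unit]. *)
Lemma tcoef_dbar {m N} : (forall i, i \in finsupp m -> (i.2 < N)%N) ->
  forall g, tcoef m (dbar g) =
  \sum_(a : A) \sum_(j < N) (m (a, val j))%:R * tcoef (raise (a, val j) m) g.
Proof.
move=> mN; elim/malg_linear_ind => [|c n g IHg].
  rewrite /dbar mlin0 tcoef0 big1 // => a _; rewrite big1 // => j _.
  by rewrite tcoef0 mulr0.
rewrite dbar_linear tcoef_linear dbarU IHg.
under [RHS]eq_bigr => a _.
  under eq_bigr => j _ do rewrite tcoef_linear mulrDr mulrCA.
  rewrite big_split /= -mulr_sumr; over.
rewrite big_split /= -mulr_sumr; congr (c * _ + _).
have [N' nN'] := finsupp_level_bound n.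
(* Raising the bound to [L] adds only zero terms on the right, and [L] also bounds the levels of
   [n]. *)
pose L := (maxn N N').
have nL i : i \in finsupp n -> (i.2 < L.+1)%N.
  by move=> /nN'; rewrite /L; lia.
pose F i := (m i)%:R * tcoef (raise i m) << n >>.
have F0 i : i \notin finsupp m -> F i = 0.
  by rewrite -cmE_eq0 /F => /eqP->; rewrite mul0r.
rewrite -[RHS](sum_levels F mN F0) (sum_levels F (N := L) _ F0); last first.
  by move=> i /mN; rewrite /L; lia.
rewrite (dbar_mon_levels nL) tcoef_sum; apply: eq_bigr => a _.
rewrite tcoef_sum; apply: eq_bigr => j _.
rewrite tcoefZU /F /tcoef mcoeffU -!natrM.
by rewrite (tcoef_lower_unit m n (a, val j)).
Qed.

End TaylorCoefficient.

(** * Reading the coefficients D off the iterates of [dbar] *)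

Section LoweringCoefficients.
Context {K : fieldType} {A : finType} {C : mindex A -> mindex A -> int}.
Hypothesis HC : lowering_coefs K C.
Implicit Types (k l m n : mindex A) (i : A * nat).

Lemma mem_lower_ok k r l :
  reflect (lower_ok k r l) (l \in fset_set [set l | lower_ok k r l]%classic).
Proof.
rewrite in_fset_set; last exact: finite_lower_ok.
by apply: (iffP idP); rewrite inE.
Qed.

Lemma iter_dbar_lowering_coefs k r :
  iter r (@dbar K A) << k >> =
  \sum_(l <- fset_set [set l | lower_ok k r l]%classic)
     (C k l)%:~R *: << lowmexp k l >>.
Proof.
have [CE _] := HC; rewrite CE; have inS := mem_lower_ok k r.
set S := fset_set _ in inS *; rewrite (fsbigE S).
- rewrite [LHS]big_seq_cond [RHS]big_seq.
  apply: eq_big => [l|l /andP[/inS[_ _ p] _]]; last by rewrite /lowmon asboolT.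
  by case: inS => //= -[ll dl _]; rewrite mem_set.
- exact: fset_uniq.
- by move=> l /inS[].
move=> l /= [ll dl] /inS nok.
by rewrite /lowmon asboolF ?scaler0 // => p; apply: nok.
Qed.

(** Distinct admissible lowering multi-indices give distinct exponents, so a single term of the
    expansion reaches this monomial. *)
Lemma tcoef_lowD {k r l} : lower_ok k r l ->
  tcoef (lowmexp k l) (iter r (@dbar K A) << k >>) = (lowD C k l)%:~R.
Proof.
move=> ok; have [ll _ p] := ok.
rewrite iter_dbar_lowering_coefs /tcoef mcoeff_sum_inj ?fset_uniq //.
- by rewrite /lowD asboolT // rmorphM mulrC.
- exact/mem_lower_ok.
by move=> l1 l2 /mem_lower_ok[ll1 _ p1] /mem_lower_ok[ll2 _ p2]; apply: lowmexp_inj.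
Qed.

Lemma tcoef_not_lower k r m : (forall l, lower_ok k r l -> lowmexp k l <> m) ->
  tcoef m (iter r (@dbar K A) << k >>) = 0.
Proof.
move=> km; rewrite iter_dbar_lowering_coefs tcoef_sum big1_seq //= => l.
by move=> /mem_lower_ok /km /eqP/negPf klm; rewrite tcoefZU klm !mulr0.
Qed.

(** Adding the unit to [l'] undoes the raising, and an exponent determines its lowering multi-index.
    So if [l (a, j.+1)] is 0, no such [l'] exists. *)
Lemma lowmexp_inj_raise k r l l' a j : lower_ok k r.+1 l -> lower_ok k r l' ->
  lowmexp k l (a, j) != 0%N -> lowmexp k l' = raise (a, j) (lowmexp k l) ->
  l = (l' * ucm (a, j.+1))%M.
Proof.
move=> [ll _ p] ok' m0 mE.
have [|[ll' _ p'] m'E] := lower_okMU (a := a) (j := j) ok'.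
  by rewrite mE /raise cmM cmUU addn1.
apply: (lowmexp_inj ll ll' p p'); rewrite m'E mE /raise mulUcmK mulmC.
by rewrite divcmUK.
Qed.

(** Removing the unit from [l] lowers the exponent only at [(a, j)], by 1, and there it is positive
    by hypothesis. *)
Lemma lower_ok_divcm {k r l a j} : lower_ok k r.+1 l -> l (a, j.+1) != 0%N ->
  lowmexp k l (a, j) != 0%N ->
  lower_ok k r (divcm l (ucm (a, j.+1))) /\
  lowmexp k (divcm l (ucm (a, j.+1))) = raise (a, j) (lowmexp k l).
Proof.
move=> [/loweringP l0 dl p] la m0; set l' := divcm _ _.
have lE : l = (l' * ucm (a, j.+1))%M by rewrite divcmUK.
have e i := lowexpMU k l' a j i; rewrite -lE in e.
have eN i : lowexp k l' i = (raise (a, j) (lowmexp k l) i)%:Z.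
  rewrite /raise cmM divcmE !cmU /= !(eq_sym _ i).
  have := e i; rewrite -(lowmexpE i p); move: m0.
  have [->|_] := eqVneq i (a, j); last first.
    by move=> _; move: (lowmexp k l i) (lowexp k l' i) (_ == _) => x y [] /=; lia.
  rewrite xpair_eqE eqxx (_ : (j == j.+1) = false) /=; last by lia.
  by move: (lowmexp k l _) (lowexp k l' _) => x y /=; lia.
have p' : lowexp_ge0 k l' by move=> i; rewrite eN.
split; last by apply/eqP/cmP => i; have := lowmexpE i p'; rewrite eN => -[].
split=> //; first by apply/loweringP => b; rewrite divcmE l0.
by move: dl; rewrite lE mdegM mdegU addn1 => -[].
Qed.

(** One term of the recursion. If the exponent at [(a, j)] is 0, both sides vanish whatever the
    value of D; otherwise the two preceding lemmas decide, according to whether [l (a, j.+1)] is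
    0. *)
Lemma tcoef_raise_lowD k r l a j : lower_ok k r.+1 l ->
  (lowmexp k l (a, j))%:R *
    tcoef (raise (a, j) (lowmexp k l)) (iter r (@dbar K A) << k >>) =
  (if (0 < l (a, j.+1))%N then
     lowD C k (divcm l (ucm (a, j.+1))) * (lowmexp k l (a, j))%:Z else 0)%:~R.
Proof.
move=> ok; have [m0|m0] := eqVneq (lowmexp k l (a, j)) 0%N.
  by rewrite m0 mul0r mulr0 if_same.
rewrite lt0n; case: ifPn => [la|/negPn/eqP la].
  have [ok' <-] := lower_ok_divcm ok la m0.
  by rewrite (tcoef_lowD ok') rmorphM mulrC.
rewrite tcoef_not_lower ?mulr0 // => l' ok' /(lowmexp_inj_raise _ _ _ _ _ _ ok ok' m0) lE.
by move: la; rewrite lE cmM cmUU; lia.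
Qed.

End LoweringCoefficients.

(** * Descent from the field to the integers, and the recursion *)

Lemma intr_inj_pchar0 {K : fieldType} : [pchar K] =i pred0 ->
  injective (fun z : int => z%:~R : K).
Proof.
move=> charK z z' /eqP; rewrite -subr_eq0 -rmorphB /= => h; apply/eqP.
rewrite -subr_eq0; move: (z - z') h => {z z'}[] n.
  by rewrite ((pcharf0P K).1 charK).
by rewrite NegzE rmorphN oppr_eq0 ((pcharf0P K).1 charK).
Qed.

Theorem proposition5p5 (A : finType) (K : fieldType) (charK : [pchar K] =i pred0)
  (C : mindex A -> mindex A -> int) (HC : lowering_coefs K C) :
  forall k : mindex A,
    lowD C k 1%M = (mfact k)%:Z /\
    forall l : mindex A, lowering l -> l <> 1%M -> lowexp_ge0 k l ->
      lowD C k l =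
      \sum_(a : A) \sum_(j \in [set j : nat | (1 <= l (a, j.+1))%N]%classic)
        lowD C k (divcm l (ucm (a, j.+1))) *
          ((k (a, j))%:Z - (l (a, j))%:Z + (l (a, j.+1))%:Z).
Proof.
(* In characteristic zero both integer identities may be checked in [K], where D is a value of
   [tcoef]. *)
move=> k; split=> [|l ll l1 p]; apply: (intr_inj_pchar0 charK).
  have ok : lower_ok k 0 1%M.
    split; rewrite ?mdeg1 //; first by apply/loweringP => a; rewrite cm1.
    by move=> i; rewrite lowexp0.
  by rewrite -(tcoef_lowD HC ok) /= lowmexp0 /tcoef mcoeffUU mulr1.
have [r dl] : exists r, mdeg l = r.+1.
  by case: (mdeg l) (@mdeg_eq0I _ l) => [/(_ erefl)|r]; [|exists r].
have ok : lower_ok k r.+1 l by [].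
rewrite -(tcoef_lowD HC ok) iterS.
(* [N1] serves the adjoint formula; [N2] ensures that the range contains every [j] with
   [l (a, j.+1)] positive. *)
have [N1 mN1] := finsupp_level_bound (lowmexp k l).
have [N2 lN2] := finsupp_level_bound l.
have mN i : i \in finsupp (lowmexp k l) -> (i.2 < maxn N1 N2)%N.
  by move=> /mN1 iN; rewrite leq_max iN.
rewrite (tcoef_dbar mN) rmorph_sum; apply: eq_bigr => a _ /=.
under eq_bigr => j _ do rewrite (tcoef_raise_lowD HC _ _ _ _ _ ok).
rewrite -rmorph_sum /=; congr (_%:~R).
pose F j := lowD C k (divcm l (ucm (a, j.+1))) * (lowmexp k l (a, j))%:Z.
rewrite -(big_mkord xpredT (fun j => if (0 < l (a, j.+1))%N then F j else 0)).
rewrite -big_mkcond /= bigfs ?iota_uniq // => [|j lj].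
  by apply: eq_fsbigr => j _; rewrite /F lowmexpE // /lowexp lshiftE.
have /lN2 /= jN2 : (a, j.+1) \in finsupp l by rewrite -cmE_neq0 -lt0n.
by rewrite mem_index_iota /= leq_max (ltnW jN2) orbT.
Qed.
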